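(* Let $G$ be a graph with a twin cover $M$, and let $(\chi^S,\delta)$ be a partial dominator coloring of $G$ with $M\subseteq S$. Then, given $\ell\in\mathbb{N}$, one can decide in polynomial time whether there exists an extension $\chi$ of $(\chi^S,\delta)$ with $|\chi|\le\ell$.
   Context: Graphs are finite and simple; $N_G[v]=N_G(v)\cup\{v\}$. A set $M\subseteq V(G)$ is a twin cover if for every edge $uv$ either $u\in M$ or $v\in M$, or $N_G[u]=N_G[v]$. A proper coloring assigns different colors to adjacent vertices; $|\chi|$ is the number of colors used. A vertex $v$ dominates a set $T$ if $T\subseteq N_G[v]$. A dominator coloring is a proper coloring of $G$ in which every vertex dominates some color class. For $S\subseteq V(G)$, a partial coloring $\chi^S:S\to C$ is a proper coloring of $G[S]$. A partial dominator coloring is a pair $(\chi^S,\delta)$ where $\chi^S$ is a partial coloring and $\delta:V(G)\to\mathrm{im}(\chi^S)$ is such that every $v\in V(G)$ dominates $(\chi^S)^{-1}(\delta(v))$. A dominator coloring $\chi$ of $G$ is an extension of $(\chi^S,\delta)$ if $\chi$ agrees with $\chi^S$ on $S$ and every $v\in V(G)$ dominates the color class $\chi^{-1}(\delta(v))$. *)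

(* Defs.v *)
From mathcomp Require Import all_boot.
Set Implicit Arguments.
Unset Strict Implicit.
Unset Printing Implicit Defensive.

(** Finite simple graphs are given by an irreflexive symmetric adjacency
    relation on a finite type; colors are natural numbers. *)

Section Coloring.
Variables (V : finType) (adj : rel V).

Definition simple_graph : Prop := irreflexive adj /\ symmetric adj.

Definition closed_nbhd (v : V) : {set V} := [set u | (u == v) || adj v u].

Definition twin_cover (M : {set V}) : Prop :=
  forall u v, adj u v ->
    [\/ u \in M, v \in M | closed_nbhd u = closed_nbhd v].

Definition dominates (v : V) (T : {set V}) : Prop := T \subset closed_nbhd v.

Definition color_class (chi : V -> nat) (c : nat) : {set V} :=
  [set v | chi v == c].

Definition num_colors (chi : V -> nat) : nat := size (undup (codom chi)).

Definition proper_coloring (chi : V -> nat) : Prop :=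
  forall u v, adj u v -> chi u <> chi v.

Definition dominator_coloring (chi : V -> nat) : Prop :=
  proper_coloring chi /\
  forall v, exists2 c, c \in codom chi & dominates v (color_class chi c).

(** A function defined on [S] only is an option-valued function on [V] whose
    value is [None] exactly outside [S]. *)
Definition partial_coloring (S : {set V}) (chiS : V -> option nat) : Prop :=
  (forall v, isSome (chiS v) = (v \in S)) /\
  (forall u v, u \in S -> v \in S -> adj u v -> chiS u <> chiS v).

Definition partial_color_class (chiS : V -> option nat) (c : nat) : {set V} :=
  [set v | chiS v == Some c].

Definition partial_dominator_coloring (S : {set V}) (chiS : V -> option nat)
    (delta : V -> nat) : Prop :=
  [/\ partial_coloring S chiS,
      forall v, Some (delta v) \in codom chiS
    & forall v, dominates v (partial_color_class chiS (delta v))].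

Definition extension (S : {set V}) (chiS : V -> option nat) (delta : V -> nat)
    (chi : V -> nat) : Prop :=
  [/\ dominator_coloring chi,
      forall v, v \in S -> chiS v = Some (chi v)
    & forall v, dominates v (color_class chi (delta v))].

(** The input handed to an algorithm: the number of vertices, the adjacency
    matrix, the characteristic vector of [M], the partial coloring (0 off [S],
    [c.+1] for color [c], so that [S] can be read off as well), [delta], and
    the bound on the number of colors. *)
Definition encode (M : {set V}) (chiS : V -> option nat) (delta : V -> nat)
    (l : nat) : seq nat :=
  #|V| :: [seq nat_of_bool (adj x y) | x <- enum V, y <- enum V]
  ++ [seq nat_of_bool (x \in M) | x <- enum V]
  ++ [seq (if chiS x is Some c then c.+1 else 0) | x <- enum V]
  ++ [seq delta x | x <- enum V]
  ++ [:: l].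

End Coloring.

(** Random access machines with a read-only array of input integers, after
    Papadimitriou, "Computational Complexity", Section 2.6: unit cost per
    instruction, addition and subtraction as the only arithmetic, input length
    measured in bits. Without multiplication, register lengths grow by at most
    one bit per step, so these machines and Turing machines simulate each other
    with polynomial overhead. *)

Inductive ram_instr : Type :=
  | IConst of nat & nat          (* R_i := c *)
  | IAdd of nat & nat & nat      (* R_i := R_j + R_k *)
  | ISub of nat & nat & nat      (* R_i := R_j - R_k, truncated at 0 *)
  | ILoad of nat & nat           (* R_i := R_(R_j) *)
  | IStore of nat & nat          (* R_(R_i) := R_j *)
  | IRead of nat & nat           (* R_i := input item number R_j, from 0 *)
  | IJump of nat                 (* goto m *)
  | IJpos of nat & nat           (* if R_j > 0 goto m *)
  | IHalt.

Definition ram_program := seq ram_instr.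

Record ram_config := RamConfig { ram_pc : nat; ram_reg : nat -> nat }.

Definition set_reg (r : nat -> nat) (i x : nat) : nat -> nat :=
  fun j => if j == i then x else r j.

(** Running past the end of the program halts; reading past the end of the
    input yields 0. *)
Definition ram_fetch (p : ram_program) (s : ram_config) : ram_instr :=
  nth IHalt p (ram_pc s).

Definition ram_step (p : ram_program) (input : seq nat) (s : ram_config) :
    ram_config :=
  let: RamConfig pc r := s in
  match ram_fetch p s with
  | IConst i c => RamConfig pc.+1 (set_reg r i c)
  | IAdd i j k => RamConfig pc.+1 (set_reg r i (r j + r k))
  | ISub i j k => RamConfig pc.+1 (set_reg r i (r j - r k))
  | ILoad i j => RamConfig pc.+1 (set_reg r i (r (r j)))
  | IStore i j => RamConfig pc.+1 (set_reg r (r i) (r j))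
  | IRead i j => RamConfig pc.+1 (set_reg r i (nth 0 input (r j)))
  | IJump m => RamConfig m r
  | IJpos j m => RamConfig (if 0 < r j then m else pc.+1) r
  | IHalt => s
  end.

Definition ram_halted (p : ram_program) (s : ram_config) : bool :=
  if ram_fetch p s is IHalt then true else false.

Definition ram_init : ram_config := RamConfig 0 (fun=> 0).

(** The answer is left in register 0: 1 for yes, 0 for no. *)
Definition ram_decides_within (p : ram_program) (input : seq nat) (t : nat)
    (Q : Prop) : Prop :=
  exists k, let s := iter k (ram_step p input) ram_init in
    [/\ k <= t, ram_halted p s
      & (Q /\ ram_reg s 0 = 1) \/ (~ Q /\ ram_reg s 0 = 0)].

Definition bit_length (n : nat) : nat := (trunc_log 2 n).+1.

Definition input_length (input : seq nat) : nat :=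
  sumn [seq bit_length x | x <- input].

(* Main.v *)
Require Import Defs.
From mathcomp Require Import all_boot.
From mathcomp Require Import zify.
Set Implicit Arguments.
Unset Strict Implicit.
Unset Printing Implicit Defensive.

(** Call an old color [c] forbidden for an uncolored vertex [u] if a neighbor of
    [u] has color [c], or if [c = delta v] for some [v] with [u] not in [N[v]].
    As [M] is a twin cover contained in [S], the uncolored vertices of [N[u]]
    are pairwise adjacent twins of [u] with the same forbidden colors, and
    uncolored vertices outside [N[u]] are not adjacent to [u]. So every such
    block can be colored on its own, new colors may be shared between blocks,
    and an extension with at most [l] colors exists iff [chiS] uses at most [l]
    colors and for every uncolored [u] the size of its block plus the number of
    its forbidden colors is at most [l].

    This criterion is the value of a closed expression built from constants,
    input items, addition, truncated subtraction and sums over the vertices.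
    Such an expression compiles to a RAM program whose running time is
    polynomial in the number of vertices, of degree the nesting depth of the
    sums. *)

(** * Summation expressions and their compilation *)

Inductive expr : Type :=
  | Var of nat
  | Const of nat
  | Len
  | Input of expr
  | Add of expr & expr
  | Sub of expr & expr
  | Sum of expr.

Section Semantics.
Variables (input : seq nat) (n : nat).

(* Variables are de Bruijn levels: [Var k] is bound by the [k]-th enclosing
   [Sum], counted from the outermost one. *)
Fixpoint eval (env : seq nat) (e : expr) : nat :=
  match e with
  | Var k => nth 0 env k
  | Const c => c
  | Len => n
  | Input e1 => nth 0 input (eval env e1)
  | Add e1 e2 => eval env e1 + eval env e2
  | Sub e1 e2 => eval env e1 - eval env e2
  | Sum e1 => \sum_(i < n) eval (rcons env i) e1
  end.

Fixpoint cost (e : expr) : nat :=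
  match e with
  | Var _ | Len => 2
  | Const _ => 1
  | Input e1 => cost e1 + 1
  | Add e1 e2 | Sub e1 e2 => cost e1 + (cost e2 + 1)
  | Sum e1 => 2 + (n * (cost e1 + 6) + 3)
  end.

End Semantics.

Lemma cost_polynomial (e : expr) :
  exists A D, forall n, cost n e <= A * n.+1 ^ D.
Proof.
have mono n D1 D2 : D1 <= D2 -> n.+1 ^ D1 <= n.+1 ^ D2.
  by move=> leD; rewrite leq_pexp2l.
have pos n D : 0 < n.+1 ^ D by rewrite expn_gt0.
have bin e1 e2 : (exists A D, forall n, cost n e1 <= A * n.+1 ^ D) ->
    (exists A D, forall n, cost n e2 <= A * n.+1 ^ D) ->
    exists A D, forall n, cost n e1 + (cost n e2 + 1) <= A * n.+1 ^ D.
  move=> [A1 [D1 H1]] [A2 [D2 H2]]; exists (A1 + A2 + 1), (D1 + D2) => n.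
  have := H1 n; have := H2 n; have := pos n (D1 + D2).
  have := mono n _ _ (leq_addr D2 D1); have := mono n _ _ (leq_addl D1 D2).
  nia.
elim: e => [k|c||e1 [A [D IH]]|e1 IH1 e2 IH2|e1 IH1 e2 IH2|e1 [A [D IH]]] /=.
- by exists 2, 0.
- by exists 1, 0.
- by exists 2, 0.
- by exists A.+1, D => n; have := IH n; have := pos n D; nia.
- exact: bin.
- exact: bin.
- exists (A + 11), D.+1 => n; rewrite expnS.
  by have := IH n; have := pos n D; nia.
Qed.

Fixpoint scoped (d : nat) (e : expr) : bool :=
  match e with
  | Var k => k < d
  | Const _ | Len => true
  | Input e1 => scoped d e1
  | Add e1 e2 | Sub e1 e2 => scoped d e1 && scoped d e2
  | Sum e1 => scoped d.+1 e1
  end.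

(* Even registers hold the loop variables, odd ones the temporaries; the
   temporary 0, that is register 1, holds the number of vertices. *)
Definition vreg (k : nat) : nat := k.*2.
Definition treg (t : nat) : nat := t.*2.+1.

Definition sum_head (b d t : nat) (size_body : nat) : seq ram_instr :=
  [:: IConst (treg t) 0; IConst (vreg d) 0;
      ISub (treg t.+1) (treg 0) (vreg d);
      IJpos (treg t.+1) (b + 5); IJump (b + 5 + size_body + 4)].

Definition sum_tail (b d t : nat) : seq ram_instr :=
  [:: IAdd (treg t) (treg t) (treg t.+1); IConst (treg t.+1) 1;
      IAdd (vreg d) (vreg d) (treg t.+1); IJump (b + 2)].

(* Code placed at address [b], with [d] variables in scope and the temporaries
   below [t] in use; the value is left in temporary [t]. *)
Fixpoint compile (b d t : nat) (e : expr) : seq ram_instr :=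
  match e with
  | Var k => [:: IConst (treg t) 0; IAdd (treg t) (treg t) (vreg k)]
  | Const c => [:: IConst (treg t) c]
  | Len => [:: IConst (treg t) 0; IAdd (treg t) (treg t) (treg 0)]
  | Input e1 => compile b d t e1 ++ [:: IRead (treg t) (treg t)]
  | Add e1 e2 =>
      let c1 := compile b d t e1 in
      c1 ++ compile (b + size c1) d t.+1 e2
         ++ [:: IAdd (treg t) (treg t) (treg t.+1)]
  | Sub e1 e2 =>
      let c1 := compile b d t e1 in
      c1 ++ compile (b + size c1) d t.+1 e2
         ++ [:: ISub (treg t) (treg t) (treg t.+1)]
  | Sum e1 =>
      let c := compile (b + 5) d.+1 t.+1 e1 in
      sum_head b d t (size c) ++ c ++ sum_tail b d t
  end.

Section Compilation.
Variables (p : ram_program) (input : seq nat).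

Definition reaches (T : nat) (s s' : ram_config) : Prop :=
  exists2 k, k <= T & iter k (ram_step p input) s = s'.

Lemma reaches_refl T s : reaches T s s.
Proof. by exists 0. Qed.

Lemma reaches_step T s s' :
  reaches T (ram_step p input s) s' -> reaches T.+1 s s'.
Proof. by case=> k le_k <-; exists k.+1; rewrite // iterSr. Qed.

Lemma reaches_instr T pc r i s' :
  nth IHalt p pc = i ->
  reaches T (match i with
    | IConst i c => RamConfig pc.+1 (set_reg r i c)
    | IAdd i j k => RamConfig pc.+1 (set_reg r i (r j + r k))
    | ISub i j k => RamConfig pc.+1 (set_reg r i (r j - r k))
    | ILoad i j => RamConfig pc.+1 (set_reg r i (r (r j)))
    | IStore i j => RamConfig pc.+1 (set_reg r (r i) (r j))
    | IRead i j => RamConfig pc.+1 (set_reg r i (nth 0 input (r j)))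
    | IJump m => RamConfig m r
    | IJpos j m => RamConfig (if 0 < r j then m else pc.+1) r
    | IHalt => RamConfig pc r
    end) s' ->
  reaches T.+1 (RamConfig pc r) s'.
Proof. by move=> Hi H; apply: reaches_step; rewrite /= /ram_fetch /= Hi. Qed.

Lemma reaches_trans T1 T2 s1 s2 s3 :
  reaches T1 s1 s2 -> reaches T2 s2 s3 -> reaches (T1 + T2) s1 s3.
Proof.
move=> [k1 le1 <-] [k2 le2 <-]; exists (k2 + k1); last by rewrite iterD.
by rewrite addnC leq_add.
Qed.

Definition code_at (b : nat) (c : seq ram_instr) : Prop :=
  forall i, i < size c -> nth IHalt p (b + i) = nth IHalt c i.

Lemma code_at_cat b c1 c2 :
  code_at b (c1 ++ c2) -> code_at b c1 /\ code_at (b + size c1) c2.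
Proof.
move=> H; split=> i lt_i.
  by rewrite H ?nth_cat ?lt_i // size_cat ltn_addr.
rewrite -addnA H ?size_cat ?ltn_add2l // nth_cat ltnNge leq_addr /=.
by rewrite addKn.
Qed.

Lemma code_at_cons b i c :
  code_at b (i :: c) -> nth IHalt p b = i /\ code_at b.+1 c.
Proof.
move=> H; split; first by have := H 0 isT; rewrite addn0.
by move=> j lt_j; have := H j.+1 lt_j; rewrite addnS addSn.
Qed.

Definition frame (d t : nat) (r r' : nat -> nat) : Prop :=
  (forall j, j < d -> r' (vreg j) = r (vreg j)) /\
  (forall j, j < t -> r' (treg j) = r (treg j)).

Lemma frame_trans d t r1 r2 r3 :
  frame d t r1 r2 -> frame d t r2 r3 -> frame d t r1 r3.
Proof.
move=> [H1 H2] [H3 H4]; split=> j lt_j; first by rewrite H3 ?H1.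
by rewrite H4 ?H2.
Qed.

Lemma frame_leq d d' t t' r r' :
  d' <= d -> t' <= t -> frame d t r r' -> frame d' t' r r'.
Proof.
by move=> led let_ [H1 H2]; split=> j lt_j; [apply: H1|apply: H2]; lia.
Qed.

Lemma set_reg_eq r i x : set_reg r i x i = x.
Proof. by rewrite /set_reg eqxx. Qed.

Lemma set_reg_neq r i j x : j <> i -> set_reg r i x j = r j.
Proof. by rewrite /set_reg; case: eqP. Qed.

Lemma frame_treg d t r k x : t <= k -> frame d t r (set_reg r (treg k) x).
Proof. by move=> le_tk; split=> j lt_j; rewrite set_reg_neq // /treg /vreg; lia. Qed.

Lemma frame_vreg d t r k x : d <= k -> frame d t r (set_reg r (vreg k) x).
Proof. by move=> le_dk; split=> j lt_j; rewrite set_reg_neq // /treg /vreg; lia. Qed.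

Definition env_regs (n : nat) (env : seq nat) (r : nat -> nat) : Prop :=
  r (treg 0) = n /\ forall k, k < size env -> r (vreg k) = nth 0 env k.

Lemma env_regs_frame n env t r r' :
  0 < t -> frame (size env) t r r' -> env_regs n env r -> env_regs n env r'.
Proof.
move=> t0 [H1 H2] [H3 H4]; split; first by rewrite H2.
by move=> k lt_k; rewrite H1 ?H4.
Qed.

Definition runs_to (n : nat) (b t : nat) (env : seq nat) (e : expr)
    (c : seq ram_instr) : Prop :=
  forall r, env_regs n env r ->
  exists r', [/\ reaches (cost n e) (RamConfig b r) (RamConfig (b + size c) r'),
                 r' (treg t) = eval input n env e
               & frame (size env) t r r'].

Lemma runs_to_binary n b t env e1 e2 c1 c2 i f :
  0 < t ->
  (forall pc r, nth IHalt p pc = i ->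
     ram_step p input (RamConfig pc r)
     = RamConfig pc.+1 (set_reg r (treg t) (f (r (treg t)) (r (treg t.+1))))) ->
  runs_to n b t env e1 c1 -> runs_to n (b + size c1) t.+1 env e2 c2 ->
  nth IHalt p (b + size c1 + size c2) = i ->
  forall r, env_regs n env r ->
  exists r', [/\ reaches (cost n e1 + (cost n e2 + 1)) (RamConfig b r)
                   (RamConfig (b + size (c1 ++ c2 ++ [:: i])) r'),
                 r' (treg t) = f (eval input n env e1) (eval input n env e2)
               & frame (size env) t r r'].
Proof.
move=> t0 step H1 H2 Hi r Hr.
have [r1 [R1 v1 F1]] := H1 r Hr.
have [r2 [R2 v2 F2]] := H2 r1 (env_regs_frame t0 F1 Hr).
have v1' : r2 (treg t) = eval input n env e1 by rewrite (proj2 F2).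
exists (set_reg r2 (treg t) (f (r2 (treg t)) (r2 (treg t.+1)))); split.
- apply: reaches_trans R1 (reaches_trans R2 _).
  apply: reaches_step; rewrite (step _ _ Hi) !size_cat /= addn1 !addnS !addnA.
  exact: reaches_refl.
- by rewrite set_reg_eq v1' v2.
- apply: frame_trans F1 (frame_trans (frame_leq _ _ F2) _) => //.
  exact: frame_treg.
Qed.

Lemma runs_to_sum n b t env e :
  0 < t ->
  (forall i, runs_to n (b + 5) t.+1 (rcons env i) e
     (compile (b + 5) (size env).+1 t.+1 e)) ->
  code_at b (compile b (size env) t (Sum e)) ->
  runs_to n b t env (Sum e) (compile b (size env) t (Sum e)).
Proof.
move=> t0 IH /=; set d := size env; set c := compile _ _ _ _.
case/code_at_cons=> h0 /code_at_cons[h1 /code_at_cons[h2]].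
case/code_at_cons=> h3 /code_at_cons[h4 /code_at_cat[_]].
have -> : b.+1.+4 = b + 5 by lia.
set b' := b + 5 + size c.
case/code_at_cons=> h5 /code_at_cons[h6 /code_at_cons[h7 /code_at_cons[h8 _]]].
move=> r Hr.
have loop m : m <= n -> exists r', [/\
    reaches (2 + m * (cost n e + 6)) (RamConfig b r) (RamConfig b.+2 r'),
    r' (treg t) = \sum_(i < m) eval input n (rcons env i) e,
    r' (vreg d) = m & frame d t r r'].
  elim: m => [_|m IHm lt_mn].
    exists (set_reg (set_reg r (treg t) 0) (vreg d) 0); split.
    - apply: (reaches_instr h0); apply: (reaches_instr h1).
      exact: reaches_refl.
    - by rewrite big_ord0 set_reg_neq ?set_reg_eq // /treg /vreg; lia.
    - by rewrite set_reg_eq.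
    - by apply: frame_trans (frame_vreg _ _ _ _); [apply: frame_treg|].
  have [r1 [R1 acc1 i1 F1]] := IHm (ltnW lt_mn).
  have n1 : r1 (treg 0) = n by rewrite (proj2 F1) ?(proj1 Hr).
  set r2 := set_reg r1 (treg t.+1) (n - m).
  have F2 : frame d.+1 t.+1 r1 r2 by apply: frame_treg.
  have E2 : env_regs n (rcons env m) r2.
    split; first by rewrite (proj2 F2).
    move=> k; rewrite size_rcons nth_rcons -/d => lt_k; rewrite (proj1 F2) //.
    case: ltnP => [lt_kd|le_dk]; first by rewrite (proj1 F1) ?(proj2 Hr).
    have -> : k = d by lia.
    by rewrite eqxx.
  have [r3 [R3 v3]] := IH m r2 E2; rewrite size_rcons -/d => F3.
  have acc3 : r3 (treg t) = \sum_(i < m) eval input n (rcons env i) e.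
    by rewrite (proj2 F3) ?(proj2 F2).
  have i3 : r3 (vreg d) = m by rewrite (proj1 F3) ?(proj1 F2).
  set r4 := set_reg r3 (treg t) (r3 (treg t) + r3 (treg t.+1)).
  set r5 := set_reg r4 (treg t.+1) 1.
  set r6 := set_reg r5 (vreg d) (r5 (vreg d) + r5 (treg t.+1)).
  have i5 : r5 (vreg d) = m.
    by rewrite /r5 /r4 !set_reg_neq ?i3 // /treg /vreg; lia.
  exists r6; split.
  - have -> : 2 + m.+1 * (cost n e + 6)
      = (2 + m * (cost n e + 6)) + (2 + (cost n e + 4)) by lia.
    apply: reaches_trans R1 _; apply: (reaches_trans (s2 := RamConfig (b + 5) r2)).
      apply: (reaches_instr h2); rewrite n1 i1 -/r2; apply: (reaches_instr h3).
      have -> : r2 (treg t.+1) = n - m by rewrite /r2 set_reg_eq.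
      by rewrite subn_gt0 lt_mn; apply: reaches_refl.
    apply: reaches_trans R3 _; rewrite -/c -/b'.
    apply: (reaches_instr h5); apply: (reaches_instr h6).
    apply: (reaches_instr h7); apply: (reaches_instr h8); rewrite addn2.
    exact: reaches_refl.
  - rewrite big_ord_recr /= /r6 set_reg_neq; last by rewrite /treg /vreg; lia.
    rewrite /r5 set_reg_neq; last by rewrite /treg; lia.
    by rewrite /r4 set_reg_eq acc3 v3.
  - by rewrite /r6 set_reg_eq i5 /r5 set_reg_eq addn1.
  - apply: frame_trans F1 (frame_trans (frame_leq _ _ F2) _) => //.
    apply: frame_trans (frame_leq _ _ F3) _ => //.
    apply: frame_trans (frame_treg _ _ _ (leqnn t)) _.
    apply: frame_trans (frame_treg _ _ _ (leqnSn t)) _.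
    exact: frame_vreg.
have [r1 [R1 acc1 i1 F1]] := loop n (leqnn n).
have n1 : r1 (treg 0) = n by rewrite (proj2 F1) ?(proj1 Hr).
exists (set_reg r1 (treg t.+1) 0); split.
- rewrite /= addnA; apply: reaches_trans R1 _; apply: (reaches_instr h2).
  rewrite n1 i1 subnn; apply: (reaches_instr h3); rewrite set_reg_eq /=.
  apply: (reaches_instr h4); rewrite size_cat /=.
  have -> : b + (size c + 4).+4.+1 = b' + 4 by rewrite /b'; lia.
  exact: reaches_refl.
- by rewrite set_reg_neq //; rewrite /treg; lia.
- exact: frame_trans F1 (frame_treg _ _ _ (leqnSn t)).
Qed.

Lemma compile_correct n e b t env :
  0 < t -> scoped (size env) e -> code_at b (compile b (size env) t e) ->
  runs_to n b t env e (compile b (size env) t e).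
Proof.
elim: e b t env => [k|c||e1 IH|e1 IH1 e2 IH2|e1 IH1 e2 IH2|e1 IH] b t env t0.
- move=> /= lt_k /code_at_cons[h0 /code_at_cons[h1 _]] r Hr.
  exists (set_reg (set_reg r (treg t) 0) (treg t) (r (vreg k))); split.
  + apply: (reaches_instr h0); apply: (reaches_instr h1).
    rewrite set_reg_eq add0n set_reg_neq; last by rewrite /treg /vreg; lia.
    by rewrite addn2; apply: reaches_refl.
  + by rewrite set_reg_eq (proj2 Hr).
  + by apply: frame_trans (frame_treg _ _ _ _); [apply: frame_treg|].
- move=> /= _ /code_at_cons[h0 _] r Hr; exists (set_reg r (treg t) c); split.
  + apply: (reaches_instr h0); rewrite addn1.
    exact: reaches_refl.
  + by rewrite set_reg_eq.
  + exact: frame_treg.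
- move=> /= _ /code_at_cons[h0 /code_at_cons[h1 _]] r Hr.
  exists (set_reg (set_reg r (treg t) 0) (treg t) (r (treg 0))); split.
  + apply: (reaches_instr h0); apply: (reaches_instr h1).
    rewrite set_reg_eq add0n set_reg_neq; last by rewrite /treg; lia.
    by rewrite addn2; apply: reaches_refl.
  + by rewrite set_reg_eq (proj1 Hr).
  + by apply: frame_trans (frame_treg _ _ _ _); [apply: frame_treg|].
- move=> /= sc /code_at_cat[h1 /code_at_cons[h2 _]] r Hr.
  have [r1 [R1 v1 F1]] := IH b t env t0 sc h1 r Hr.
  exists (set_reg r1 (treg t) (nth 0 input (r1 (treg t)))); split.
  + apply: reaches_trans R1 _; apply: (reaches_instr h2).
    rewrite size_cat /= addn1 addnS.
    exact: reaches_refl.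
  + by rewrite set_reg_eq v1.
  + exact: frame_trans F1 (frame_treg _ _ _ (leqnn t)).
- move=> /= /andP[s1 s2] /code_at_cat[h1 /code_at_cat[h2 /code_at_cons[h3 _]]].
  apply: (runs_to_binary (f := addn) t0 _ (IH1 _ _ _ t0 s1 h1)
            (IH2 _ _ _ _ s2 h2) h3) => // pc r.
  by rewrite /ram_step /ram_fetch /= => ->.
- move=> /= /andP[s1 s2] /code_at_cat[h1 /code_at_cat[h2 /code_at_cons[h3 _]]].
  apply: (runs_to_binary (f := subn) t0 _ (IH1 _ _ _ t0 s1 h1)
            (IH2 _ _ _ _ s2 h2) h3) => // pc r.
  by rewrite /ram_step /ram_fetch /= => ->.
- move=> sc h; apply: runs_to_sum => // i.
  have [/= _ h'] := @code_at_cat b (sum_head b (size env) t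
    (size (compile (b + 5) (size env).+1 t.+1 e1))) _ h.
  have [h1 _] := code_at_cat h'.
  by have := IH (b + 5) t.+1 (rcons env i) isT; rewrite size_rcons; apply.
Qed.

End Compilation.

Definition program (e : expr) : ram_program :=
  IConst 0 0 :: IRead 1 0 :: compile 2 0 1 e ++ [:: IConst 0 0; IAdd 0 0 3].

Lemma program_correct (e : expr) (input : seq nat) (Q : Prop) :
  scoped 0 e -> reflect Q (0 < eval input (nth 0 input 0) [::] e) ->
  eval input (nth 0 input 0) [::] e <= 1 ->
  ram_decides_within (program e) input (cost (nth 0 input 0) e + 4) Q.
Proof.
set n := nth 0 input 0 => sc QP le1; pose p := program e.
have code : code_at p 0 p by move=> i; rewrite add0n.
have [h0 /code_at_cons[h1 /code_at_cat[hc]]] := code_at_cons code.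
case/code_at_cons=> h2 /code_at_cons[h3 _].
pose r0 := set_reg (set_reg (fun=> 0) 0 0) 1 n.
have E0 : env_regs n [::] r0 by split.
have [r1 [R1 v1 F1]] := @compile_correct p input n e 2 1 [::] isT sc hc r0 E0.
set q := 2 + _ in R1.
have [k le_k Ek] : reaches p input (cost n e + 4) ram_init
    (RamConfig q.+2 (set_reg (set_reg r1 0 0) 0 (r1 3))).
  have -> : cost n e + 4 = 2 + (cost n e + 2) by lia.
  apply: (reaches_trans (s2 := RamConfig 2 r0)).
    apply: (reaches_instr h0); apply: (reaches_instr h1).
    exact: reaches_refl.
  apply: reaches_trans R1 _; apply: (reaches_instr h2).
  apply: (reaches_instr h3).
  exact: reaches_refl.
exists k; rewrite Ek; split=> //=.
  rewrite /ram_halted /ram_fetch /= nth_default //.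
  by rewrite /p /program /= size_cat /= addn2.
rewrite set_reg_eq; have -> : r1 3 = eval input n [::] e := v1.
have [pos|le0] := ltnP 0 (eval input n [::] e); [left|right].
  by split; [apply/QP | lia].
by split; [move/QP | ]; lia.
Qed.

(** * The counting criterion *)

Section Criterion.
Variables (V : finType) (adj : rel V) (M S : {set V}).
Variables (chiS : V -> option nat) (delta : V -> nat).
Hypothesis Gsimple : simple_graph adj.
Hypothesis Mtwin : twin_cover adj M.
Hypothesis pdc : partial_dominator_coloring adj S chiS delta.
Hypothesis MS : M \subset S.

Notation N := (closed_nbhd adj).

Definition color_code (x : V) : nat := if chiS x is Some c then c.+1 else 0.

Definition used_colors : seq nat :=
  [seq c.-1 | c <- [seq c <- undup [seq color_code x | x <- enum V] | 0 < c]].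

(* The colors of [chiS] that no extension can give to the uncolored [u]. *)
Definition forbidden (u : V) (c : nat) : bool :=
  [exists v, (adj u v && (chiS v == Some c))
             || ((delta v == c) && (u \notin N v))].

Definition block (u : V) : {set V} := N u :\: S.

Lemma used_colorsP c : reflect (exists x, chiS x = Some c) (c \in used_colors).
Proof.
apply: (iffP mapP) => [[c' +->]|[x Ex]].
  rewrite mem_filter mem_undup => /andP[c'0 /mapP[x _ E]]; exists x.
  by move: E c'0; rewrite /color_code; case: (chiS x) => [b ->|->].
exists c.+1 => //; rewrite mem_filter mem_undup /=; apply/mapP.
by exists x; rewrite ?mem_enum // /color_code Ex.
Qed.

Lemma used_colors_uniq : uniq used_colors.
Proof.
rewrite map_inj_in_uniq ?filter_uniq ?undup_uniq //.
by move=> [|x] [|y]; rewrite !mem_filter //= => _ _ ->.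
Qed.

Lemma count_used_colors (P : pred nat) :
  count P used_colors
  = count (fun c => (0 < c) && P c.-1) (undup [seq color_code x | x <- enum V]).
Proof.
rewrite count_map count_filter; apply: eq_count => c /=.
by rewrite andbC.
Qed.

Lemma chiS_out x : x \notin S -> chiS x = None.
Proof.
by have [[dom _] _ _] := pdc; rewrite -dom; case: (chiS x).
Qed.

Lemma mem_nbhd u v : (v \in N u) = (v == u) || adj u v.
Proof. by rewrite inE. Qed.

Lemma nbhd_sym u v : (v \in N u) = (u \in N v).
Proof. by have [_ sym] := Gsimple; rewrite !mem_nbhd eq_sym sym. Qed.

Lemma twin_nbhd u w : u \notin S -> w \notin S -> w \in N u -> N w = N u.
Proof.
move=> uS wS; rewrite mem_nbhd => /predU1P[->//|uw].
by have [uM|wM|->//] := Mtwin uw; [have := subsetP MS u uM | have := subsetP MS w wM];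
  rewrite ?(negPf uS) ?(negPf wS).
Qed.

Lemma adj_twin u w v :
  N w = N u -> v != w -> v != u -> adj w v = adj u v.
Proof.
move=> E vw vu; have := congr1 (fun A : {set V} => v \in A) E.
by rewrite !mem_nbhd (negPf vw) (negPf vu).
Qed.

Lemma forbidden_twin u w c :
  u \notin S -> w \notin S -> N w = N u -> forbidden w c = forbidden u c.
Proof.
move=> uS wS E; apply: eq_existsb => v; congr (_ || _); last first.
  by rewrite -!(nbhd_sym _ v) E.
have [Ev|] := eqVneq (chiS v) (Some c); rewrite ?andbF // !andbT.
apply: adj_twin => //; apply/eqP => Evx; move: Ev; rewrite Evx chiS_out //.
Qed.

Lemma extension_necessary chi l :
  extension adj S chiS delta chi -> num_colors chi <= l ->
  size used_colors <= l /\
  forall u, u \notin S -> #|block u| + count (forbidden u) used_colors <= l.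
Proof.
move=> [[proper _] agree dom] le_l.
have chiSE x c : chiS x = Some c -> chi x = c.
  move=> Ex; have [xS|xS] := boolP (x \in S); last by rewrite chiS_out in Ex.
  by have := agree x xS; rewrite Ex => -[].
have used_codom c : c \in used_colors -> c \in undup (codom chi).
  by case/used_colorsP=> x /chiSE <-; rewrite mem_undup codom_f.
split=> [|u uS].
  by apply: leq_trans le_l; apply: uniq_leq_size used_colors_uniq used_codom.
rewrite cardE -size_filter -(size_map chi) -size_cat.
apply: leq_trans le_l; apply: uniq_leq_size; last first.
  move=> c; rewrite mem_cat => /orP[/mapP[x _ ->]|].
    by rewrite mem_undup codom_f.
  by rewrite mem_filter => /andP[_ /used_codom].
have blockP w : w \in enum (block u) -> w \notin S /\ N w = N u.
  by rewrite mem_enum inE => /andP[wS wu]; split=> //; apply: twin_nbhd.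
rewrite cat_uniq filter_uniq ?used_colors_uniq // andbT; apply/andP; split.
  rewrite map_inj_in_uniq ?enum_uniq // => w w' /blockP[_ E] /blockP[_ E'] Ec.
  have : w' \in N w by rewrite E -E' mem_nbhd eqxx.
  by rewrite mem_nbhd => /predU1P[->//|/proper].
apply/hasPn=> c; rewrite mem_filter => /andP[+ _].
apply: contraL => /mapP[w /blockP[wS E] ->].
rewrite -(forbidden_twin _ uS wS E); apply/existsP => -[v].
case/orP=> [/andP[wv /eqP/chiSE Ev]|/andP[/eqP Ed /negP[]]].
  exact: proper wv (esym Ev).
by apply: (subsetP (dom v)); rewrite inE Ed.
Qed.

(* Twins share one palette: the admissible old colors followed by the
   [l - size used_colors] new ones; each uses the color at its own rank. *)
Definition palette (l : nat) (u : V) : seq nat :=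
  [seq c <- used_colors | ~~ forbidden u c]
  ++ iota (\max_(c <- used_colors) c).+1 (l - size used_colors).

Definition extend (l : nat) (u : V) : nat :=
  if chiS u is Some c then c
  else nth 0 (palette l u) (index u (enum (block u))).

Lemma used_colors_max c :
  c \in used_colors -> c <= \max_(c' <- used_colors) c'.
Proof. by move=> cK; apply: (@leq_bigmax_seq _ _ predT id). Qed.

Lemma palette_uniq l u : uniq (palette l u).
Proof.
rewrite cat_uniq filter_uniq ?used_colors_uniq // iota_uniq andbT /=.
apply/hasPn=> c; rewrite mem_iota mem_filter => /andP[lt_c _].
by apply/negP=> /andP[_ /used_colors_max]; lia.
Qed.

Lemma extension_sufficient l :
  size used_colors <= l ->
  (forall u, u \notin S -> #|block u| + count (forbidden u) used_colors <= l) ->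
  extension adj S chiS delta (extend l) /\ num_colors (extend l) <= l.
Proof.
move=> le_used le_block; have [[domS properS] deltaS domdelta] := pdc.
have [_ sym] := Gsimple.
have extS x c : chiS x = Some c -> extend l x = c by rewrite /extend => ->.
have inS x : x \in S -> {c | chiS x = Some c}.
  by rewrite -domS; case: (chiS x) => // c _; exists c.
have self u : u \notin S -> u \in block u.
  by move=> uS; rewrite inE uS mem_nbhd eqxx.
have lt_idx u : u \notin S -> index u (enum (block u)) < size (palette l u).
  move=> uS; have: index u (enum (block u)) < #|block u|.
    by rewrite cardE index_mem mem_enum self.
  have := le_block u uS; rewrite size_cat size_filter size_iota.
  have <- : size used_colors - count (forbidden u) used_colors
      = count (fun c => ~~ forbidden u c) used_colors.
    by rewrite -(count_predC (forbidden u)) addKn.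
  by have := count_size (forbidden u) used_colors; lia.
have ext_out u : u \notin S ->
    extend l u = nth 0 (palette l u) (index u (enum (block u))).
  by move=> uS; rewrite /extend chiS_out.
have extP u : u \notin S -> extend l u \in palette l u.
  by move=> uS; rewrite ext_out // mem_nth ?lt_idx.
have ext_used u : u \notin S -> extend l u \in used_colors ->
    ~~ forbidden u (extend l u).
  move=> uS used; have := extP u uS; rewrite mem_cat mem_filter mem_iota.
  by case/orP=> /andP[] // lt_c; have := used_colors_max used; lia.
have mixed u v : u \notin S -> v \in S -> adj u v -> extend l u <> extend l v.
  move=> uS /inS[c Ev] uv E; have Ec := extS _ _ Ev.
  have used : extend l u \in used_colors.
    by rewrite E Ec; apply/used_colorsP; exists v.
  have := ext_used u uS used; rewrite negb_exists => /forallP/(_ v).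
  by rewrite uv E Ec Ev eqxx.
have proper : proper_coloring adj (extend l).
  move=> u v uv; have [uS|uS] := boolP (u \in S); have [vS|vS] := boolP (v \in S).
  - have [c Ec] := inS u uS; have [c' Ec'] := inS v vS.
    rewrite (extS _ _ Ec) (extS _ _ Ec') => E.
    by apply: (properS u v) => //; rewrite Ec Ec' E.
  - by move/esym; apply: mixed => //; rewrite sym.
  - exact: mixed.
  - have vu : v \in N u by rewrite mem_nbhd uv orbT.
    have EN := twin_nbhd uS vS vu.
    have Eb : block v = block u by rewrite /block EN.
    have Ep : palette l v = palette l u.
      by congr cat; apply: eq_filter => c; rewrite (forbidden_twin c uS vS EN).
    rewrite !ext_out // Ep Eb => /eqP.
    rewrite nth_uniq ?palette_uniq ?lt_idx //; last first.
      by rewrite -Ep -Eb lt_idx.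
    have [irr _] := Gsimple => /eqP/(@index_inj _ u) Euv.
    by move: uv; rewrite Euv ?irr // mem_enum ?self // -Eb self.
have dom v : dominates adj v (color_class (extend l) (delta v)).
  apply/subsetP=> w; rewrite inE => /eqP Ew.
  have [wS|wS] := boolP (w \in S).
    have [c Ec] := inS w wS; apply: (subsetP (domdelta v)).
    by rewrite inE -Ew (extS _ _ Ec) Ec.
  have used : extend l w \in used_colors.
    by rewrite Ew; apply/used_colorsP; have /codomP[x] := deltaS v; exists x.
  have := ext_used w wS used; rewrite negb_exists => /forallP/(_ v).
  by rewrite Ew eqxx negb_or negbK => /andP[].
split.
  split=> //; last by move=> v /inS[c Ec]; rewrite Ec (extS _ _ Ec).
  split=> // v; exists (delta v); last exact: dom.
  have /codomP[x Ex] := deltaS v.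
  by rewrite -(extS _ _ (esym Ex)) codom_f.
apply: (@leq_trans (size (used_colors ++
    iota (\max_(c <- used_colors) c).+1 (l - size used_colors)))); last first.
  by rewrite size_cat size_iota subnKC.
apply: uniq_leq_size (undup_uniq _) _ => c; rewrite mem_undup => /codomP[x ->].
have [xS|xS] := boolP (x \in S).
  have [c' Ec] := inS x xS; rewrite mem_cat (extS _ _ Ec).
  by apply/orP; left; apply/used_colorsP; exists x.
have := extP x xS; rewrite !mem_cat mem_filter => /orP[/andP[_ ->]//|->].
by rewrite orbT.
Qed.

Lemma extension_criterion l :
  (exists chi, extension adj S chiS delta chi /\ num_colors chi <= l) <->
  size used_colors <= l /\
  forall u, u \notin S -> #|block u| + count (forbidden u) used_colors <= l.
Proof.
split=> [[chi [ext le_l]]|[H1 H2]]; first exact: extension_necessary ext le_l.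
by exists (extend l); apply: extension_sufficient.
Qed.

End Criterion.

(** * The deciding expression *)

Definition Not (e : expr) : expr := Sub (Const 1) e.
Definition And (e1 e2 : expr) : expr := Not (Add (Not e1) (Not e2)).
Definition Or (e1 e2 : expr) : expr := Not (Not (Add e1 e2)).
Definition Le (e1 e2 : expr) : expr := Not (Sub e1 e2).
Definition Lt (e1 e2 : expr) : expr := Not (Le e2 e1).
Definition Eq (e1 e2 : expr) : expr := Not (Add (Sub e1 e2) (Sub e2 e1)).
Definition Ex (e : expr) : expr := Not (Not (Sum e)).

(* [Sum e] with an unused summation index is multiplication by the number of
   vertices; it computes the offsets of the sections of the input. *)
Definition Adj (x y : nat) : expr :=
  Input (Add (Const 1) (Add (Sum (Var x)) (Var y))).
Definition Field (k : expr) : expr :=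
  Input (Add (Const 1) (Add (Sum Len) k)).
Definition Col (x : nat) : expr := Field (Add Len (Var x)).
Definition Del (x : nat) : expr := Field (Add Len (Add Len (Var x))).
Definition Bound : expr := Field (Add Len (Add Len Len)).

Definition LastOccurrence (w v : nat) : expr :=
  And (Col w) (Not (Ex (And (Lt (Var w) (Var v)) (Eq (Col v) (Col w))))).

Definition Forbidden (u w v : nat) : expr :=
  Ex (Or (And (Adj u v) (Eq (Col v) (Col w)))
         (And (Eq (Add (Const 1) (Del v)) (Col w))
              (Not (Or (Eq (Var u) (Var v)) (Adj v u))))).

Definition Demand (u w v : nat) : expr :=
  Sum (Add (And (Not (Col w)) (Or (Eq (Var w) (Var u)) (Adj u w)))
           (And (LastOccurrence w v) (Forbidden u w v))).

Definition decider : expr :=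
  And (Le (Sum (LastOccurrence 0 1)) Bound)
      (Not (Ex (And (Not (Col 0)) (Lt Bound (Demand 0 1 2))))).

Section EvalLogic.
Variables (input : seq nat) (n : nat) (env : seq nat).
Notation ev := (eval input n env).

Lemma eval_Add e1 e2 : ev (Add e1 e2) = ev e1 + ev e2.
Proof. by []. Qed.

Lemma eval_Sum e : ev (Sum e) = \sum_(i < n) eval input n (rcons env i) e.
Proof. by []. Qed.

Lemma eval_Not e : ev (Not e) = ~~ (0 < ev e).
Proof. by rewrite /=; lia. Qed.

Lemma eval_And e1 e2 : ev (And e1 e2) = (0 < ev e1) && (0 < ev e2).
Proof. by rewrite /=; lia. Qed.

Lemma eval_Or e1 e2 : ev (Or e1 e2) = (0 < ev e1) || (0 < ev e2).
Proof. by rewrite /=; lia. Qed.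

Lemma eval_Le e1 e2 : ev (Le e1 e2) = (ev e1 <= ev e2).
Proof. by rewrite /=; lia. Qed.

Lemma eval_Lt e1 e2 : ev (Lt e1 e2) = (ev e1 < ev e2).
Proof. by rewrite /=; lia. Qed.

Lemma eval_Eq e1 e2 : ev (Eq e1 e2) = (ev e1 == ev e2).
Proof. by rewrite /=; lia. Qed.

Lemma eval_Ex e :
  ev (Ex e) = [exists i : 'I_n, 0 < eval input n (rcons env i) e].
Proof.
have -> : ev (Ex e) = (0 < \sum_(i < n) eval input n (rcons env i) e).
  by rewrite /=; lia.
rewrite lt0n sum_nat_eq0 negb_forall; congr nat_of_bool.
by apply: eq_existsb => i; rewrite /= lt0n.
Qed.

End EvalLogic.

Lemma nth_allpairs_row (A B T : Type) (f : A -> B -> T) z a b s t i j :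
  i < size s -> j < size t ->
  nth z [seq f x y | x <- s, y <- t] (size t * i + j)
  = f (nth a s i) (nth b t j).
Proof.
elim: s i => // x s IH [|i] lt_i lt_j; rewrite /= nth_cat size_map.
  by rewrite muln0 lt_j (nth_map b).
rewrite ltnNge mulnS -addnA leq_addr /= addKn; exact: IH.
Qed.

Lemma count_undup (T : eqType) (z : T) (P : pred T) (s : seq T) :
  count P (undup s)
  = \sum_(i < size s) (P (nth z s i) && (nth z s i \notin drop i.+1 s)).
Proof.
elim: s => [|x s IH]; first by rewrite big_ord0.
by rewrite big_ord_recl /= drop0 -IH; case: (x \in s); rewrite ?andbF ?andbT.
Qed.

Lemma mem_drop_nth (T : eqType) (z x : T) (s : seq T) k :
  (x \in drop k s) = [exists j : 'I_(size s), (k <= j) && (nth z s j == x)].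
Proof.
apply/idP/existsP => [/(nthP z)[j]|[j /andP[le_kj /eqP <-]]].
  rewrite size_drop nth_drop => lt_j <-.
  have lt_kj : k + j < size s by lia.
  by exists (Ordinal lt_kj); rewrite /= leq_addr eqxx.
rewrite -(subnKC le_kj) -nth_drop mem_nth // size_drop.
by have := ltn_ord j; lia.
Qed.

Lemma exists_enum_val (T : finType) (P : pred T) :
  [exists i : 'I_#|T|, P (enum_val i)] = [exists x, P x].
Proof.
apply/existsP/existsP => [[i Pi]|[x Px]]; first by exists (enum_val i).
by exists (enum_rank x); rewrite enum_rankK.
Qed.

Lemma card_enum_val (T : finType) (A : {set T}) :
  #|A| = \sum_(i < #|T|) (enum_val i \in A).
Proof.
rewrite -sum1_card big_mkcond -(big_enum_val (fun x => nat_of_bool (x \in A))).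
by apply: eq_big => // x _; case: (x \in A).
Qed.

Section Decider.
Variables (V : finType) (adj : rel V) (M S : {set V}).
Variables (chiS : V -> option nat) (delta : V -> nat) (l : nat).
Hypothesis pdc : partial_dominator_coloring adj S chiS delta.

Let input := encode adj M chiS delta l.
Let n := #|V|.
Notation ev := (eval input n).
Notation x_ := (@enum_val V V).

Lemma nth_enum_map (f : V -> nat) (i : 'I_n) :
  nth 0 [seq f x | x <- enum V] i = f (x_ i).
Proof.
rewrite (nth_map (x_ i)) -?cardE ?ltn_ord //; congr f.
by rewrite -enum_val_nth.
Qed.

Lemma eval_Adj env a b (i j : 'I_n) :
  a < size env -> nth 0 env a = i -> nth 0 env b = j ->
  ev env (Adj a b) = adj (x_ i) (x_ j).
Proof.
move=> lt_a Ea Eb; rewrite /= Eb.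
under eq_bigr do rewrite nth_rcons lt_a Ea.
rewrite sum_nat_const card_ord /= nth_cat size_allpairs -cardE -/n.
have -> : n * i + j < n * n by have := ltn_ord i; have := ltn_ord j; nia.
rewrite {1}/n cardE (nth_allpairs_row _ _ (x_ i) (x_ i)) -?cardE //.
by rewrite -!enum_val_nth.
Qed.

Lemma eval_Field env k :
  ev env (Field k) = nth 0
    ([seq nat_of_bool (x \in M) | x <- enum V]
     ++ [seq color_code chiS x | x <- enum V] ++ [seq delta x | x <- enum V]
     ++ [:: l]) (ev env k).
Proof.
rewrite /= sum_nat_const card_ord /= nth_cat size_allpairs -cardE -/n.
by rewrite add0n ltnNge leq_addr /= addKn.
Qed.

Lemma eval_Col env a (i : 'I_n) :
  nth 0 env a = i -> ev env (Col a) = color_code chiS (x_ i).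
Proof.
move=> Ea; rewrite eval_Field /= Ea nth_cat size_map -cardE -/n.
rewrite ltnNge leq_addr /= addKn nth_cat size_map -cardE ltn_ord.
exact: nth_enum_map.
Qed.

Lemma eval_Del env a (i : 'I_n) :
  nth 0 env a = i -> ev env (Del a) = delta (x_ i).
Proof.
move=> Ea; rewrite eval_Field /= Ea.
do 2! rewrite nth_cat size_map -cardE -/n ltnNge leq_addr /= addKn.
rewrite nth_cat size_map -cardE ltn_ord; exact: nth_enum_map.
Qed.

Lemma eval_Bound env : ev env Bound = l.
Proof.
rewrite eval_Field /=.
do 2! rewrite nth_cat size_map -cardE -/n ltnNge leq_addr /= addKn.
by rewrite nth_cat size_map -cardE ltnn subnn.
Qed.

Let codes := [seq color_code chiS x | x <- enum V].

Lemma eval_LastOccurrence env w (i : 'I_n) :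
  w < size env -> nth 0 env w = i ->
  ev env (LastOccurrence w (size env)) =
    (0 < color_code chiS (x_ i)) && (nth 0 codes i \notin drop i.+1 codes).
Proof.
move=> lt_w Ew; rewrite eval_And eval_Not eval_Ex !lt0b (eval_Col Ew).
have sz : size codes = n by rewrite size_map -cardE.
congr (nat_of_bool (_ && ~~ _)); rewrite (mem_drop_nth 0) sz.
apply: eq_existsb => j; rewrite eval_And eval_Lt eval_Eq !lt0b.
have Ew' : nth 0 (rcons env j) w = i by rewrite nth_rcons lt_w.
have Ev' : nth 0 (rcons env j) (size env) = j by rewrite nth_rcons ltnn eqxx.
by rewrite (eval_Col Ew') (eval_Col Ev') /= Ew' Ev' !nth_enum_map.
Qed.

Lemma eval_Forbidden env u w (i j : 'I_n) :
  u < size env -> w < size env -> nth 0 env u = i -> nth 0 env w = j ->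
  0 < color_code chiS (x_ j) ->
  ev env (Forbidden u w (size env))
  = forbidden adj chiS delta (x_ i) (color_code chiS (x_ j)).-1.
Proof.
move=> lt_u lt_w Eu Ew pos_j; rewrite eval_Ex /forbidden -exists_enum_val.
congr nat_of_bool; apply: eq_existsb => k.
have Eu' : nth 0 (rcons env k) u = i by rewrite nth_rcons lt_u.
have Ew' : nth 0 (rcons env k) w = j by rewrite nth_rcons lt_w.
have Ev' : nth 0 (rcons env k) (size env) = k by rewrite nth_rcons ltnn eqxx.
rewrite eval_Or !eval_And !eval_Eq eval_Not eval_Or eval_Eq !lt0b.
rewrite (eval_Col Ew') (eval_Col Ev') (eval_Adj _ Eu' Ev') ?(eval_Adj _ Ev' Eu');
  try by rewrite size_rcons; lia.
have -> : ev (rcons env k) (Add (Const 1) (Del (size env))) = (delta (x_ k)).+1.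
  by rewrite -(eval_Del Ev').
rewrite !lt0b /= Eu' Ev' inE (inj_eq enum_val_inj).
move: pos_j; rewrite /color_code; case: (chiS (x_ j)) => // c _ /=.
by congr (_ && _ || _); case: (chiS (x_ k)).
Qed.

Lemma sum_LastOccurrence (P : pred nat) :
  \sum_(i < n) ((0 < color_code chiS (x_ i))
      && (nth 0 codes i \notin drop i.+1 codes)
      && P (color_code chiS (x_ i)).-1)
  = count P (used_colors chiS).
Proof.
rewrite count_used_colors (count_undup 0) size_map -cardE -/n.
by apply: eq_bigr => i _; rewrite nth_enum_map andbAC.
Qed.

Lemma color_code_eq0 x : (color_code chiS x == 0) = (x \notin S).
Proof.
have [[dom _] _ _] := pdc; rewrite -dom /color_code.
by case: (chiS x).
Qed.

Lemma eval_Demand (u : 'I_n) :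
  ev [:: val u] (Demand 0 1 2)
  = #|block adj S (x_ u)|
    + count (forbidden adj chiS delta (x_ u)) (used_colors chiS).
Proof.
rewrite /Demand eval_Sum -sum_LastOccurrence card_enum_val -big_split; apply: eq_bigr => w _.
rewrite eval_Add; congr addn.
  rewrite eval_And eval_Not eval_Or eval_Eq !lt0b.
  rewrite (@eval_Col _ _ w) // (@eval_Adj _ _ _ u w) // lt0b -eqn0Ngt.
  rewrite color_code_eq0 2!inE /= (inj_eq enum_val_inj).
  by case: (_ && _).
rewrite eval_And (@eval_LastOccurrence [:: val u; val w] 1 w) // lt0b.
case: ltnP => // pos_w; rewrite !andTb.
by rewrite (@eval_Forbidden [:: val u; val w] 0 1 u w) // lt0b.
Qed.

Lemma eval_decider :
  ev [::] decider =
    (size (used_colors chiS) <= l)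
    && [forall u, (u \notin S) ==>
          (#|block adj S u| + count (forbidden adj chiS delta u) (used_colors chiS)
           <= l)].
Proof.
rewrite eval_And eval_Le eval_Not eval_Ex eval_Bound !lt0b.
congr (nat_of_bool ((_ <= l) && _)).
  rewrite -count_predT -sum_LastOccurrence eval_Sum; apply: eq_bigr => i _.
  by rewrite (@eval_LastOccurrence [:: val i] 0 i) // andbT.
rewrite negb_exists -[RHS]negbK negb_forall -exists_enum_val negb_exists.
apply: eq_forallb => u; rewrite eval_And eval_Not eval_Lt !lt0b.
rewrite (@eval_Col _ _ u) // eval_Bound eval_Demand -eqn0Ngt color_code_eq0.
by rewrite negb_imply -ltnNge.
Qed.

Lemma size_encode : n < size input.
Proof.
by rewrite /input /encode /= !size_cat !(size_map _ (enum V)) -!cardE -/n; lia.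
Qed.

End Decider.

Lemma size_input_length s : size s <= input_length s.
Proof. by elim: s => //= x s IH; rewrite /input_length /= -addn1 addnC leq_add. Qed.

Theorem theorem9 :
  exists (p : ram_program) (a d : nat),
  forall (V : finType) (adj : rel V) (M S : {set V})
         (chiS : V -> option nat) (delta : V -> nat),
    simple_graph adj ->
    twin_cover adj M ->
    partial_dominator_coloring adj S chiS delta ->
    M \subset S ->
    forall l : nat,
      let input := encode adj M chiS delta l in
      ram_decides_within p input (a * input_length input ^ d + a)
        (exists chi : V -> nat,
           extension adj S chiS delta chi /\ num_colors chi <= l).
Proof.
have [A [D cost_le]] := cost_polynomial decider.
exists (program decider), (A + 4), D => V adj M S chiS delta Gs Mt pdc MS l input.
have eval_n := eval_decider M l pdc.
have [k [le_k halt out]] : ram_decides_within (program decider) input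
    (cost #|V| decider + 4)
    (exists chi, extension adj S chiS delta chi /\ num_colors chi <= l).
  apply: program_correct => //; last by rewrite eval_n leq_b1.
  rewrite eval_n lt0b; apply: (iffP andP).
    move=> [H1 /forallP H2]; apply/(extension_criterion Gs Mt pdc MS); split=> // u.
    exact: (implyP (H2 u)).
  case/(extension_criterion Gs Mt pdc MS) => H1 H2; split=> //.
  by apply/forallP=> u; apply/implyP/H2.
exists k; split=> //; apply: leq_trans le_k _; rewrite leq_add ?leq_addl //.
apply: leq_trans (cost_le _) _; rewrite leq_mul ?leq_addr //.
have [->//|D0] := posnP D; rewrite leq_exp2r //.
exact: leq_trans (size_encode adj M chiS delta l) (size_input_length _).
Qed.
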